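(* Let $\mathcal{H}$, $A$, $B$, $c$, $d$, $\Omega$, $W_\Omega(T)$ and $W_{\partial\Omega}(T)$ be as in the context. Then (i) $W_\Omega(T)\cap i\mathbb{R}=W_{\partial\Omega}(T)\cap i\mathbb{R}$; (ii) $\partial W_\Omega(T)\setminus i\mathbb{R}=W_{\partial\Omega}(T)\setminus i\mathbb{R}$.
   Context: Let $\mathcal{H}$ be a Hilbert space, $A$ a selfadjoint (possibly unbounded) operator in $\mathcal{H}$ and $B$ a nonzero bounded selfadjoint operator in $\mathcal{H}$. Let $c\ge 0$ and $d>0$ be real numbers, $\theta:=\sqrt{c-d^2/4}$ (principal square root) and $\delta_\pm:=\pm\theta-id/2$, the zeros of $c-id\omega-\omega^2$. For $u\in\operatorname{dom}A\setminus\{0\}$ the numerical ranges are $W(A)=\{(Au,u)/(u,u)\}$, $W(B)=\{(Bu,u)/(u,u)\}\subset\mathbb{R}$. For real $\alpha,\beta$ let $p_{(\alpha,\beta)}(\omega):=(\alpha-\omega^2)(c-id\omega-\omega^2)-\beta\omega^2$, and let $r_1,\dots,r_4:\mathbb{R}^2\to\mathbb{C}$ denote its four roots, labelled so that each $r_n$ is continuous in $(\alpha,\beta)$; they are extended to $\overline{\mathbb{R}}\times\mathbb{R}$, where $\overline{\mathbb{R}}=\mathbb{R}\cup\{\pm\infty\}$, with values in the Riemann sphere $\overline{\mathbb{C}}=\mathbb{C}\cup\{\infty\}$, by taking limits (as $\alpha\to\pm\infty$ the roots tend to $\delta_+,\delta_-$ and to $\infty$ twice). For $X\subset\overline{\mathbb{R}}\times\mathbb{R}$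 put $W_X(T):=\bigcup_{n=1}^4\bigcup_{(\alpha,\beta)\in X}r_n(\alpha,\beta)\subset\overline{\mathbb{C}}$. Let $\Omega:=\overline{W(A)}\times\overline{W(B)}$, where $\overline{W(A)}$ is the closure in $\overline{\mathbb{R}}$ (containing $\pm\infty$ when $W(A)$ is unbounded above/below). $W_\Omega(T)$ is an enclosure of the numerical range of $T(\omega)=A-\omega^2-\frac{\omega^2}{c-id\omega-\omega^2}B$, and $W_{\partial\Omega}(T)=\bigcup_{n}r_n(\partial\Omega)$, where $\partial\Omega$ is the boundary of the rectangle $\Omega$. *)

(* Defs.v *)
From mathcomp Require Import all_boot all_order all_algebra.
From mathcomp Require Import all_classical all_reals all_analysis.
From mathcomp.real_closed Require Export complex.
Export GRing.Theory Num.Theory numFieldTopology.Exports ComplexField.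

Set Implicit Arguments.
Unset Strict Implicit.
Unset Printing Implicit Defensive.

Local Open Scope ring_scope.
Local Open Scope classical_set_scope.

Section Defs.
Context {R : realType} {H : lmodType R[i]}.

Definition inner_product (ip : H -> H -> R[i]) : Prop :=
  [/\ forall (a : R[i]) (u v w : H), ip (a *: u + v) w = a * ip u w + ip v w,
      forall u v : H, ip v u = conjc (ip u v),
      forall u : H, 0 <= ip u u
    & forall u : H, ip u u = 0 -> u = 0].

Definition hnorm (ip : H -> H -> R[i]) (u : H) : R := Num.sqrt (complex.Re (ip u u)).

Definition hcomplete (ip : H -> H -> R[i]) : Prop :=
  forall s : nat -> H,
    (forall e : R, 0 < e -> exists N : nat, forall m n : nat,
        (N <= m)%N -> (N <= n)%N -> hnorm ip (s m - s n) < e) ->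
    exists l : H, forall e : R, 0 < e -> exists N : nat, forall n : nat,
        (N <= n)%N -> hnorm ip (s n - l) < e.

Definition hilbert_space (ip : H -> H -> R[i]) : Prop :=
  inner_product ip /\ hcomplete ip.

Definition linear_on (dom : set H) (A : H -> H) : Prop :=
  dom 0 /\
  forall (a : R[i]) (u v : H), dom u -> dom v ->
    dom (a *: u + v) /\ A (a *: u + v) = a *: A u + A v.

Definition densely_defined (ip : H -> H -> R[i]) (dom : set H) : Prop :=
  forall (v : H) (e : R), 0 < e -> exists u, dom u /\ hnorm ip (u - v) < e.

Definition adjoint_dom (ip : H -> H -> R[i]) (dom : set H) (A : H -> H) : set H :=
  [set v | exists w : H, forall u : H, dom u -> ip (A u) v = ip u w].

(** A is selfadjoint (possibly unbounded): densely defined, linear, symmetric,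
    and dom A^* = dom A (so that A^* = A). *)
Definition selfadjoint (ip : H -> H -> R[i]) (dom : set H) (A : H -> H) : Prop :=
  [/\ linear_on dom A, densely_defined ip dom,
      (forall u v : H, dom u -> dom v -> ip (A u) v = ip u (A v))
    & adjoint_dom ip dom A = dom].

Definition bounded_selfadjoint (ip : H -> H -> R[i]) (B : H -> H) : Prop :=
  [/\ linear_on setT B,
      (exists M : R, forall u : H, hnorm ip (B u) <= M * hnorm ip u)
    & forall u v : H, ip (B u) v = ip u (B v)].

Definition num_range (ip : H -> H -> R[i]) (dom : set H) (A : H -> H) : set R :=
  [set x : R | exists u : H, [/\ dom u, u <> 0 & ip (A u) u / ip u u = x%:C%C]].

Definition Omega (ip : H -> H -> R[i]) (domA : set H) (A B : H -> H) : set (\bar R * R) :=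
  closure (EFin @` num_range ip domA A) `*` closure (num_range ip setT B).

End Defs.

Section Roots.
Context {R : realType}.

Definition tboundary (X : set (\bar R * R)) : set (\bar R * R) :=
  closure X `\` interior X.

Definition p_ab (c d a b : R) (w : R[i]) : R[i] :=
  (a%:C%C - w ^+ 2) * (c%:C%C - 'i%C * d%:C%C * w - w ^+ 2) - b%:C%C * w ^+ 2.

Definition theta (c d : R) : R[i] :=
  if 0 <= c - d ^+ 2 / 4 then (Num.sqrt (c - d ^+ 2 / 4))%:C%C
  else 'i%C * (Num.sqrt (d ^+ 2 / 4 - c))%:C%C.

Definition delta_p (c d : R) : R[i] := theta c d - 'i%C * (d / 2)%:C%C.
Definition delta_m (c d : R) : R[i] := - theta c d - 'i%C * (d / 2)%:C%C.

(** The Riemann sphere: [None] is the point at infinity. *)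
Notation sphere := (option R[i]).

(** The set {r_1(a,b), ..., r_4(a,b)} of roots, extended to a = +-oo by limits
    (two roots tend to delta_+, delta_-, the other two to infinity). *)
Definition roots_at (c d : R) (ab : \bar R * R) : set sphere :=
  match ab.1 with
  | EFin a => [set z | exists w : R[i], z = Some w /\ p_ab c d a ab.2 w = 0]
  | _ => [set Some (delta_p c d); Some (delta_m c d); None]
  end.

Definition W_T (c d : R) (X : set (\bar R * R)) : set sphere :=
  [set z | exists2 ab, X ab & roots_at c d ab z].

Definition imag_axis : set sphere := [set z | exists y : R, z = Some (Complex 0 y)].

Definition sphere_ball (z : sphere) (e : R) : set sphere :=
  match z with
  | Some z0 => [set y | exists w : R[i], y = Some w /\ `|w - z0| < e%:C%C]
  | None => [set y | y = None \/ exists w : R[i], y = Some w /\ e^-1%:C%C < `|w|]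
  end.

Definition sphere_boundary (S : set sphere) : set sphere :=
  [set z | forall e : R, 0 < e ->
     (exists y, sphere_ball z e y /\ S y) /\ (exists y, sphere_ball z e y /\ ~ S y)].

End Roots.

(* Main.v *)
(** Only two features of [Omega] matter: it is closed, and its second
    coordinate is bounded because [B] is bounded.
    On the imaginary axis the equation [p_ab c d a b w = 0] is a single real
    affine equation in [(a, b)], so the parameters having the root [w] form a
    line (or everything); this line leaves [Omega], hence meets its boundary.
    Off the imaginary axis [p_ab c d a b w = 0] is a real 2x2 linear system in
    [(a, b)] with determinant [rdet].  Where [rdet] does not vanish, [(a, b)]
    is a continuous function of [w], so that [w] is interior to the enclosure
    when [(a, b)] is interior to [Omega]; conversely, moving [(a, b)] slightly
    out of [Omega] moves a root only slightly.  Where [rdet] vanishes, [w] lies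
    on a circle on which only [delta_p] and [delta_m] can belong to the
    enclosure, and these are limits of other points of that circle.
    Compactness of the extended real line makes the enclosure closed in the
    Riemann sphere. *)
Require Import Defs.
From mathcomp Require Import all_boot all_order all_algebra.
From mathcomp Require Import all_classical all_reals all_analysis.
From mathcomp.real_closed Require Import complex.
From mathcomp Require Import ring lra.
Import Order.TTheory GRing.Theory Num.Theory numFieldTopology.Exports ComplexField.
Import numFieldNormedType.Exports.
Local Open Scope ring_scope.
Local Open Scope classical_set_scope.

(** * Topology of the parameter space: the extended line times the real line *)

Section ExtendedPlane.
Context {R : realType}.
Implicit Types (X : set (\bar R * R)) (a x y b M : R).

(** Neighbourhoods of the two infinities absorb everything outside a segment, and segments are
    compact. *)
Lemma ereal_compact : compact [set: \bar R].
Proof.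
apply/compact_near_coveringP => I F P FF cov.
have [[U V] /= [[M [_ UM]] FV] UVP] := cov +oo%E Logic.I.
have [[U' V'] /= [[M' [_ UM']] FV'] UVP'] := cov -oo%E Logic.I.
have segM : compact `[M', M] by exact: segment_compact.
have /= := (iffLR (compact_near_coveringP _) segM) I F (fun i x => P i x%:E) FF.
move=> /(_ _)/wrap[x _|FM].
  have [[A B] /= [Ax FB] ABP] := cov x%:E Logic.I.
  by exists ([set x | A x%:E], B) => //= -[u v] [Au Bv]; exact: (ABP (u%:E, v)).
near=> i => x _.
have Vi : V i by near: i.
have V'i : V' i by near: i.
case: x => [x||].
- have [Mx|xM] := ltP M x.
    by apply: (UVP (x%:E, i)); split => //=; apply: UM; rewrite lte_fin.
  have [Mx'|xM'] := ltP x M'.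
    by apply: (UVP' (x%:E, i)); split => //=; apply: UM'; rewrite lte_fin.
  by have : `[M', M] `<=` (fun x => P i x%:E); [near: i|apply; rewrite /= in_itv/= xM'].
- by apply: (UVP (+oo%E, i)); split => //=; apply: UM; rewrite ltry.
- by apply: (UVP' (-oo%E, i)); split => //=; apply: UM'; rewrite ltNyr.
Unshelve. all: by end_near. Qed.

Lemma closed_bounded_compact X M :
  closed X -> (forall ab, X ab -> `|ab.2| <= M) -> compact X.
Proof.
move=> cX bX.
apply: (@subclosed_compact _ _ ([set: \bar R] `*` `[- M, M])) => //.
  by apply: compact_setX; [exact: ereal_compact|exact: segment_compact].
by move=> ab /bX; rewrite ler_norml => abM; split => //=; rewrite in_itv.
Qed.

(** If the path avoided the boundary, the preimage of [X] would equal that of its interior. It would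
    then be open, closed and nonempty in the connected line, hence contain [t]. *)
Lemma path_meets_tboundary X (f : R -> \bar R * R) s t :
  closed X -> continuous f -> X (f s) -> ~ X (f t) ->
  exists r, tboundary X (f r).
Proof.
move=> cX cf Xs Xt; apply: contrapT => nob.
have XI r : X (f r) -> interior X (f r).
  move=> Xr; apply: contrapT => nI; apply: nob; exists r; split => //.
  exact: subset_closure.
have /connected_intervalP : is_interval [set: R] by move=> ? ? _ _ ?.
move=> /(_ (f @^-1` X)) H; apply: Xt.
suff : (f @^-1` X) t by [].
rewrite H//; first by exists s.
- exists (f @^-1` X^°).
    apply: open_comp; [by move=> ? _; exact: cf|exact: open_interior].
  rewrite setTI; apply/seteqP; split => r /=; first exact: XI.
  exact: interior_subset.
- exists (f @^-1` X); last by rewrite setTI.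
  by apply: preimage_closed => // ? _; exact: cf.
Qed.

Lemma tboundary_sub X : closed X -> tboundary X `<=` X.
Proof. by move=> /closure_id {2}-> ab []. Qed.

Lemma continuous_pair_fun (f : R -> \bar R) (g : R -> R) :
  continuous f -> continuous g -> continuous (fun t => (f t, g t)).
Proof. by move=> cf cg t; exact: (cvg_pair (cf t) (cg t)). Qed.

Lemma tboundary_vertical X M (e : \bar R) b : closed X ->
  (forall ab, X ab -> `|ab.2| <= M) -> X (e, b) ->
  exists b', tboundary X (e, b').
Proof.
move=> cX bX Xeb.
(* The ordinate [|M| + 1] exceeds [M], so the vertical line has left [X] there. *)
apply: (@path_meets_tboundary X (fun t => (e, t)) b (`|M| + 1)) => //.
- apply: continuous_pair_fun => t; [exact: cvg_cst|exact: cvg_id].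
- move=> /bX /=; rewrite ger0_norm ?addr_ge0// => h.
  by have := ler_norm M; lra.
Qed.

Lemma EFin_continuous : continuous (@EFin R).
Proof. by move=> x; apply: cvg_EFin => //; near=> y. Unshelve. all: end_near. Qed.

(** A horizontal line may stay in [X]. Its limit at [+oo] then lies in the closed set [X], and a
    vertical move finds a boundary point there, perhaps at another ordinate. This does no harm,
    since roots at an infinite first parameter do not depend on the second. *)
Lemma tboundary_horizontal X M a b : closed X ->
  (forall ab, X ab -> `|ab.2| <= M) -> X (a%:E, b) ->
  exists2 ab, tboundary X ab & ab.1 \is a fin_num -> ab.2 = b.
Proof.
move=> cX bX Xab.
have cf : continuous (fun t : R => (t%:E, b)).
  by apply: continuous_pair_fun => t; [exact: EFin_continuous|exact: cvg_cst].
have [Xall|/existsNP[t Xt]] := pselect (forall t : R, X (t%:E, b)).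
  have : X (+oo%E, b).
    apply: cX => /= B [[U V] /= [[K [_ UK]] Vb] UVB].
    exists ((K + 1)%:E, b); split => //; apply: UVB; split => /=.
      by apply: UK; rewrite lte_fin ltrDl.
    exact: nbhs_singleton.
  by move=> /(tboundary_vertical _ _ _ _ cX bX)[b' Xb']; exists (+oo%E, b').
have [r Xr] := path_meets_tboundary X _ a t cX cf Xab Xt.
by exists (r%:E, b).
Qed.

End ExtendedPlane.

(** * The quartic as a real linear system in its two parameters *)

Section Quartic.
Context {R : realType}.
Variables (c d : R).
Implicit Types (a b x y : R).

(* With [w = x + iy], [sqre + i sqim] is [w^2], [qre + i qim] is
   [c - idw - w^2] and [pre + i pim] is [p_ab c d a b w]. *)
Definition sqre x y := x * x - y * y.
Definition sqim x y := 2 * x * y.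
Definition qre x y := c + d * y - sqre x y.
Definition qim x y := - (d * x) - sqim x y.
Definition pre a b x y :=
  (a - sqre x y) * qre x y + sqim x y * qim x y - b * sqre x y.
Definition pim a b x y :=
  (a - sqre x y) * qim x y - sqim x y * qre x y - b * sqim x y.

(* The determinant of the real linear system [p_ab c d a b w = 0] in the
   unknowns [(a, b)]. *)
Definition rdet x y := x * (2 * c * y + d * (x * x + y * y)).

Lemma q_complexE x y :
  c%:C%C - 'i%C * d%:C%C * (x +i* y)%C - (x +i* y)%C ^+ 2
    = (qre x y +i* qim x y)%C.
Proof.
by rewrite expr2; simpc; apply/eqP; rewrite eq_complex /=; apply/andP; split;
  apply/eqP; rewrite /qre /qim /sqre /sqim; ring.
Qed.

Lemma p_abE a b x y :
  p_ab c d a b (x +i* y)%C = (pre a b x y +i* pim a b x y)%C.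
Proof.
rewrite /p_ab q_complexE expr2; simpc.
apply/eqP; rewrite eq_complex /=; apply/andP; split; apply/eqP;
  rewrite /pre /pim /qre /qim /sqre /sqim; ring.
Qed.

Lemma p_ab_eq0 a b x y :
  p_ab c d a b (x +i* y)%C = 0 <-> pre a b x y = 0 /\ pim a b x y = 0.
Proof.
rewrite p_abE; split; first by case.
by case=> -> ->.
Qed.

Lemma sqr_theta : theta c d ^+ 2 = (c - d ^+ 2 / 4)%:C%C.
Proof.
rewrite /theta; case: ifPn => [t0|].
  by rewrite -rmorphXn/= sqr_sqrtr.
rewrite -ltNge => t0; rewrite exprMn sqr_i -rmorphXn/= sqr_sqrtr; last by lra.
by simpc; congr (_ +i* _)%C; ring.
Qed.

Lemma delta_factor (w : R[i]) :
  (w - delta_p c d) * (w - delta_m c d)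
    = - (c%:C%C - 'i%C * d%:C%C * w - w ^+ 2).
Proof.
have -> : (w - delta_p c d) * (w - delta_m c d)
    = (w + 'i%C * (d / 2)%:C%C) ^+ 2 - theta c d ^+ 2.
  by rewrite /delta_p /delta_m; ring.
rewrite sqr_theta; case: w => x y; rewrite !expr2; simpc.
by apply/eqP; rewrite eq_complex /=; apply/andP; split; apply/eqP; field.
Qed.

Lemma roots_at_fin a b x y : roots_at c d (a%:E, b) (Some (x +i* y)%C) <->
  pre a b x y = 0 /\ pim a b x y = 0.
Proof.
rewrite -p_ab_eq0; split => [[w [[<-]]]//|pw0]; by exists (x +i* y)%C.
Qed.

Lemma roots_at_infty (e : \bar R) b x y : e \isn't a fin_num ->
  roots_at c d (e, b) (Some (x +i* y)%C) <-> qre x y = 0 /\ qim x y = 0.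
Proof.
move=> einf.
have -> : roots_at c d (e, b) =
    [set Some (delta_p c d); Some (delta_m c d); None] by case: e einf.
split => [|[q1 q2]].
  have q0 w : (w - delta_p c d) * (w - delta_m c d) = 0 -> w = (x +i* y)%C ->
      qre x y = 0 /\ qim x y = 0.
    move=> + ew; rewrite ew delta_factor q_complexE => /eqP.
    by rewrite oppr_eq0 eq_complex /= => /andP[/eqP -> /eqP ->].
  case=> [[|]|//] [] e0; apply: (q0 (x +i* y)%C) => //.
    by rewrite -e0 subrr mul0r.
  by rewrite -e0 subrr mulr0.
have /eqP : ((x +i* y)%C - delta_p c d) * ((x +i* y)%C - delta_m c d) = 0.
  by rewrite delta_factor q_complexE q1 q2; simpc.
by rewrite mulf_eq0 !subr_eq0 => /orP[] /eqP ->; left; [left|right].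
Qed.

(** Cramer elimination: weighting the two real equations by the parts of [c - idw - w^2] cancels
    [a]. Weighting them by the parts of [w^2], as in [elim_b], cancels [b]. *)
Lemma elim_a a b x y : pre a b x y * qim x y - pim a b x y * qre x y
  = sqim x y * (qre x y * qre x y + qim x y * qim x y) + b * rdet x y.
Proof. by rewrite /pre /pim /rdet /qre /qim /sqre /sqim; ring. Qed.

Lemma elim_b a b x y : pre a b x y * sqim x y - pim a b x y * sqre x y
  = (a - sqre x y) * rdet x y
    + sqim x y * (sqim x y * qim x y + sqre x y * qre x y).
Proof. by rewrite /pre /pim /rdet /qre /qim /sqre /sqim; ring. Qed.

Lemma rdetE x y : rdet x y = sqim x y * qre x y - sqre x y * qim x y.
Proof. by rewrite /rdet /qre /qim /sqre /sqim; ring. Qed.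

(** With zero determinant, [elim_a] leaves a product of [sqim] and the squared modulus of
    [c - idw - w^2]. If [sqim] vanished, then [y = 0] and [rdet] would be [d * x ^ 3], which is
    nonzero. *)
Lemma rdet0_pre_pim a b x y : d != 0 -> rdet x y = 0 -> x != 0 ->
  pre a b x y = 0 -> pim a b x y = 0 -> qre x y = 0 /\ qim x y = 0.
Proof.
move=> d0 D0 x0 p1 p2; have := elim_a a b x y.
rewrite p1 p2 D0 !mul0r subrr mulr0 addr0 => /esym/eqP; rewrite mulf_eq0.
move=> /orP[|]; last first.
  by rewrite -!expr2 paddr_eq0 ?sqr_ge0// !sqrf_eq0 => /andP[/eqP ? /eqP].
rewrite /sqim !mulf_eq0 pnatr_eq0 (negbTE x0)/= => /eqP y0.
move: D0 => /eqP; rewrite /rdet y0 !mulr0 add0r addr0 !mulf_eq0.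
by rewrite (negbTE x0) (negbTE d0).
Qed.

Definition sol_a x y := sqre x y
  - sqim x y * (sqim x y * qim x y + sqre x y * qre x y) / rdet x y.
Definition sol_b x y :=
  - (sqim x y * (qre x y * qre x y + qim x y * qim x y)) / rdet x y.

Lemma pre_pim_sol a b x y : rdet x y != 0 ->
  (pre a b x y = 0 /\ pim a b x y = 0) <-> (a = sol_a x y /\ b = sol_b x y).
Proof.
move=> D0; split=> [[p1 p2]|[-> ->]].
  have := elim_a a b x y; have := elim_b a b x y.
  rewrite p1 p2 !mul0r subrr => Eb Ea; split; apply: (mulIf D0).
    by rewrite /sol_a mulrBl divfK//; lra.
  by rewrite /sol_b divfK//; lra.
set a' := sol_a x y; set b' := sol_b x y.
have Ea : pre a' b' x y * qim x y - pim a' b' x y * qre x y = 0.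
  by rewrite elim_a /b' /sol_b divfK//; ring.
have Eb : pre a' b' x y * sqim x y - pim a' b' x y * sqre x y = 0.
  by rewrite elim_b /a' /sol_a addrAC subrr add0r mulNr divfK// addNr.
(* Undoing the elimination: suitable combinations of the two vanishing expressions are [rdet] times
   [pre] and [rdet] times [pim]. *)
by split; apply: (mulIf D0); rewrite mul0r rdetE; set p1 := pre _ _ _ _ in Ea Eb *;
  set p2 := pim _ _ _ _ in Ea Eb *;
  [transitivity (qre x y * (p1 * sqim x y - p2 * sqre x y)
                 - sqre x y * (p1 * qim x y - p2 * qre x y))
  |transitivity (qim x y * (p1 * sqim x y - p2 * sqre x y)
                 - sqim x y * (p1 * qim x y - p2 * qre x y))];
  by [ring|rewrite Ea Eb !mulr0 subrr].
Qed.

End Quartic.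

(** * Continuity of the real expressions along an arbitrary filter *)

Section Limits.
Context {R : realType} {T : Type} {F : set_system T} {FF : Filter F}.
Variables (c d : R) (fa fb fx fy : T -> R) (a b x y : R).
Hypotheses (ca : fa t @[t --> F] --> a) (cb : fb t @[t --> F] --> b).
Hypotheses (cx : fx t @[t --> F] --> x) (cy : fy t @[t --> F] --> y).

Let cst (k : R) : (fun _ : T => k) @ F --> k.
Proof. exact: cvg_cst. Qed.

Lemma cvg_sqre : sqre (fx t) (fy t) @[t --> F] --> sqre x y.
Proof. exact: (cvgB (cvgM cx cx) (cvgM cy cy)). Qed.

Lemma cvg_sqim : sqim (fx t) (fy t) @[t --> F] --> sqim x y.
Proof. exact: (cvgM (cvgM (cst 2) cx) cy). Qed.

Lemma cvg_qre : qre c d (fx t) (fy t) @[t --> F] --> qre c d x y.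
Proof.
exact: (cvgB (cvgD (cst c) (cvgM (cst d) cy)) cvg_sqre).
Qed.

Lemma cvg_qim : qim d (fx t) (fy t) @[t --> F] --> qim d x y.
Proof. exact: (cvgB (cvgN (cvgM (cst d) cx)) cvg_sqim). Qed.

Lemma cvg_pre :
  pre c d (fa t) (fb t) (fx t) (fy t) @[t --> F] --> pre c d a b x y.
Proof.
exact: (cvgB (cvgD (cvgM (cvgB ca cvg_sqre) cvg_qre)
  (cvgM cvg_sqim cvg_qim)) (cvgM cb cvg_sqre)).
Qed.

Lemma cvg_pim :
  pim c d (fa t) (fb t) (fx t) (fy t) @[t --> F] --> pim c d a b x y.
Proof.
exact: (cvgB (cvgB (cvgM (cvgB ca cvg_sqre) cvg_qim)
  (cvgM cvg_sqim cvg_qre)) (cvgM cb cvg_sqim)).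
Qed.

Lemma cvg_rdet : rdet c d (fx t) (fy t) @[t --> F] --> rdet c d x y.
Proof.
exact: (cvgM cx (cvgD (cvgM (cst (2 * c)) cy)
  (cvgM (cst d) (cvgD (cvgM cx cx) (cvgM cy cy))))).
Qed.

Lemma cvg_sol_a : rdet c d x y != 0 ->
  sol_a c d (fx t) (fy t) @[t --> F] --> sol_a c d x y.
Proof.
move=> D0; exact: (cvgB cvg_sqre (cvgM (cvgM cvg_sqim
  (cvgD (cvgM cvg_sqim cvg_qim) (cvgM cvg_sqre cvg_qre)))
  (cvgV D0 cvg_rdet))).
Qed.

Lemma cvg_sol_b : rdet c d x y != 0 ->
  sol_b c d (fx t) (fy t) @[t --> F] --> sol_b c d x y.
Proof.
move=> D0; exact: (cvgM (cvgN (cvgM cvg_sqim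
  (cvgD (cvgM cvg_qre cvg_qre) (cvgM cvg_qim cvg_qim))))
  (cvgV D0 cvg_rdet)).
Qed.

End Limits.

(** * Not being a root is an open condition, also at infinite parameters *)

Section RootsNear.
Context {R : realType}.
Variables (c d : R).

Lemma near_infty (e : \bar R) (K : R) : e \isn't a fin_num ->
  \forall e' \near e, e' \is a fin_num -> K < `|fine e'|.
Proof.
case: e => [//|_|_].
  near=> e' => e'fin; apply: (@lt_le_trans _ _ (fine e')); last exact: ler_norm.
  by rewrite -lte_fin fineK//; near: e'; exact: nbhs_open_ereal_pinfty.
near=> e' => e'fin; apply: (@lt_le_trans _ _ (- fine e')).
  rewrite ltrNr -lte_fin fineK//; near: e'; exact: nbhs_open_ereal_ninfty.
by rewrite -normrN ler_norm.
Unshelve. all: by end_near. Qed.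

(** At a finite limit parameter, [pre] or [pim] is nonzero and stays so. At an infinite one,
    [q = c - idw - w^2] is nonzero in the limit; a root at a finite [a] satisfies
    [a q = w^2 (q + b)], which bounds [a] nearby, whereas [a] must become large. *)
Lemma cvg_not_roots {T : Type} {F : set_system T} {FF : Filter F}
    (fe : T -> \bar R) (fb fx fy : T -> R) (e : \bar R) (b x y : R) :
  fe t @[t --> F] --> e -> fb t @[t --> F] --> b ->
  fx t @[t --> F] --> x -> fy t @[t --> F] --> y ->
  ~ roots_at c d (e, b) (Some (x +i* y)%C) ->
  \forall t \near F, ~ roots_at c d (fe t, fb t) (Some (fx t +i* fy t)%C).
Proof.
move=> ce cb cx cy nroot.
have [efin|einf] := boolP (e \is a fin_num).
  have ea : e = (fine e)%:E by rewrite fineK.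
  move: ce nroot; rewrite ea; set a := fine e => ce nroot.
  have [nfin ca] := (iffLR (fine_cvgP _ _) ce).
  have [p1|p1] := eqVneq (pre c d a b x y) 0.
    have [p2|p2] := eqVneq (pim c d a b x y) 0.
      by case: nroot; apply/roots_at_fin.
    have cp : pim c d (fine (fe t)) (fb t) (fx t) (fy t) @[t --> F] -->
        pim c d a b x y by exact: cvg_pim.
    have np : \forall t \near F,
        pim c d (fine (fe t)) (fb t) (fx t) (fy t) != 0.
      exact: cvgr_neq0 cp p2.
    near=> t; have : fe t \is a fin_num by near: t.
    have : pim c d (fine (fe t)) (fb t) (fx t) (fy t) != 0 by near: t.
    case: (fe t) => [a'||] //= np' _ /roots_at_fin[_ p0].
    by rewrite p0 eqxx in np'.
  have cp : pre c d (fine (fe t)) (fb t) (fx t) (fy t) @[t --> F] -->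
      pre c d a b x y by exact: cvg_pre.
  have np : \forall t \near F,
      pre c d (fine (fe t)) (fb t) (fx t) (fy t) != 0.
    exact: cvgr_neq0 cp p1.
  near=> t; have : fe t \is a fin_num by near: t.
  have : pre c d (fine (fe t)) (fb t) (fx t) (fy t) != 0 by near: t.
  case: (fe t) => [a'||] //= np' _ /roots_at_fin[p0 _].
  by rewrite p0 eqxx in np'.
(* [N] is the squared modulus of [q], and [A1 + i A2] is [w^2 (q + k)]. The quotient [L] below
   therefore equals [a ^ 2] at a root. *)
pose N u v := qre c d u v * qre c d u v + qim d u v * qim d u v.
pose A1 k u v := sqre u v * qre c d u v - sqim u v * qim d u v + k * sqre u v.
pose A2 k u v := sqre u v * qim d u v + sqim u v * qre c d u v + k * sqim u v.
have q0 : N x y != 0.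
  apply/negP; rewrite /N -!expr2 paddr_eq0 ?sqr_ge0// !sqrf_eq0.
  by move=> /andP[/eqP q1 /eqP q2]; apply: nroot; apply/roots_at_infty.
have csre : sqre (fx t) (fy t) @[t --> F] --> sqre x y by exact: cvg_sqre.
have csim : sqim (fx t) (fy t) @[t --> F] --> sqim x y by exact: cvg_sqim.
have cqre : qre c d (fx t) (fy t) @[t --> F] --> qre c d x y by exact: cvg_qre.
have cqim : qim d (fx t) (fy t) @[t --> F] --> qim d x y by exact: cvg_qim.
have cN : N (fx t) (fy t) @[t --> F] --> N x y.
  by exact: (cvgD (cvgM cqre cqre) (cvgM cqim cqim)).
have cA1 : A1 (fb t) (fx t) (fy t) @[t --> F] --> A1 b x y.
  by exact: (cvgD (cvgB (cvgM csre cqre) (cvgM csim cqim)) (cvgM cb csre)).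
have cA2 : A2 (fb t) (fx t) (fy t) @[t --> F] --> A2 b x y.
  by exact: (cvgD (cvgD (cvgM csre cqim) (cvgM csim cqre)) (cvgM cb csim)).
pose L k u v := (A1 k u v * A1 k u v + A2 k u v * A2 k u v) / N u v.
have cL : L (fb t) (fx t) (fy t) @[t --> F] --> L b x y.
  by exact: (cvgM (cvgD (cvgM cA1 cA1) (cvgM cA2 cA2)) (cvgV q0 cN)).
(* Taking [K] at least 1 makes [|a| > K] imply [a ^ 2 > K], against [L < K]. *)
pose K := `|L b x y| + 1.
have LK : L b x y < K by rewrite (le_lt_trans (ler_norm _))// ltrDl.
have K1 : 1 <= K by rewrite lerDr.
have nN : \forall t \near F, N (fx t) (fy t) != 0 by exact: cvgr_neq0 cN q0.
have nL : \forall t \near F, L (fb t) (fx t) (fy t) < K by exact: cvgr_lt cL _ LK.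
have ne : \forall t \near F, fe t \is a fin_num -> K < `|fine (fe t)|.
  exact: (ce _ (near_infty e K einf)).
near=> t.
have Nt : N (fx t) (fy t) != 0 by near: t.
have Lt : L (fb t) (fx t) (fy t) < K by near: t.
have : fe t \is a fin_num -> K < `|fine (fe t)| by near: t.
have [fin /(_ isT)|inf _] := boolP (fe t \is a fin_num); last first.
  move=> /(iffLR (roots_at_infty _ _ _ _ _ _ inf))[q1 q2].
  by move: Nt; rewrite /N q1 q2 mulr0 addr0 eqxx.
move: fin; case: (fe t) => [a||] //= _ Ka /roots_at_fin[p1 p2].
move: Lt; rewrite ltNge => /negP; apply.
have -> : L (fb t) (fx t) (fy t) = `|a| ^+ 2.
  rewrite real_normK ?num_real//; apply: (mulIf Nt); rewrite divfK//.
  have -> : A1 (fb t) (fx t) (fy t) = a * qre c d (fx t) (fy t).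
    by move: p1; rewrite /A1 /pre; lra.
  have -> : A2 (fb t) (fx t) (fy t) = a * qim d (fx t) (fy t).
    by move: p2; rewrite /A2 /pim; lra.
  by rewrite /N; ring.
nra.
Unshelve. all: by end_near. Qed.


End RootsNear.

(** * Balls of the sphere around finite points against neighbourhoods in the real plane *)

Section SphereBall.
Context {R : realType}.
Implicit Types (z : R * R) (e : R).

Notation cplx z := (z.1 +i* z.2)%C.

Lemma complex_norm_lt (u v e : R) :
  `|u| < e / 2 -> `|v| < e / 2 -> `|(u +i* v)%C| < e%:C%C.
Proof.
move=> ue ve; rewrite normc_def ltcR /=.
have e0 : 0 < e by have := normr_ge0 u; lra.
rewrite -[ltRHS]gtr0_norm// -sqrtr_sqr ltr_sqrt ?exprn_gt0//.
move: ue ve; rewrite !ltr_norml => /andP[u1 u2] /andP[v1 v2].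
nra.
Qed.

Lemma sphere_ball_near z e : 0 < e ->
  \forall z' \near z, sphere_ball (Some (cplx z)) e (Some (cplx z')).
Proof.
move=> e0; have e20 : 0 < e / 2 by rewrite divr_gt0.
apply/nbhs_ballP; exists (e / 2) => //= -[x y] [/= bx by_].
exists (x +i* y)%C; split=> //.
case: z bx by_ => x0 y0 /= bx by_.
have -> : (x +i* y)%C - (x0 +i* y0)%C = ((x - x0) +i* (y - y0))%C by [].
by apply: complex_norm_lt; rewrite distrC.
Qed.

Lemma near_sphere_ball z (P : set (R * R)) : nbhs z P ->
  exists2 e, 0 < e & forall y,
    sphere_ball (Some (cplx z)) e y -> exists2 z', y = Some (cplx z') & P z'.
Proof.
move=> /nbhs_ballP[e /= e0 eP]; exists e => // y [[x1 y1] [-> ze]].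
exists (x1, y1) => //; apply: eP; case: z ze => x0 y0; simpc => /= ze.
have n (u v : R) : `|u| <= Num.sqrt (u ^+ 2 + v ^+ 2).
  by rewrite -sqrtr_sqr ler_wsqrtr// lerDl sqr_ge0.
split; rewrite /ball /= distrC; apply: le_lt_trans ze; first exact: n.
by rewrite [X in Num.sqrt X]addrC; exact: n.
Qed.

End SphereBall.

(** * A priori bound on roots and closedness of the enclosure in the sphere *)

Lemma norm_bound {R : realType} (K c d r u v k : R) :
  0 <= c -> 0 < d -> 0 <= k -> k <= K -> 0 <= u -> 0 <= v ->
  r ^+ 2 <= u + K -> r ^+ 2 <= v + (c + d * r) -> u * v = k * r ^+ 2 ->
  r < 4 * (K + c + d + 1).
Proof.
move=> c0 d0 k0 kK u0 v0 h1 h2 E; rewrite ltNge; apply/negP => rK.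
have r4 : 4 <= r by lra.
have r2 : r ^+ 2 >= r * (4 * (K + c + d + 1)) by rewrite expr2 ler_wpM2l//; lra.
have Kr : K <= r * K by rewrite ler_peMl//; lra.
have cr : c <= r * c by rewrite ler_peMl//; lra.
(* For such large [r], the term [r ^ 2] is at least twice each of [K] and [c + d * r]. So [u] and
   [v] are at least [r ^ 2 / 2], and their product forces [r ^ 2 <= 4 * K], which is too small. *)
have u2 : 2 * u >= r ^+ 2 by nra.
have v2 : 2 * v >= r ^+ 2 by nra.
have s0 : 0 < r ^+ 2 by rewrite exprn_gt0//; lra.
have : r ^+ 2 * r ^+ 2 <= 4 * K * r ^+ 2.
  apply: (@le_trans _ _ (4 * (u * v))); first by nra.
  by rewrite E; have := ler_wpM2r (ltW s0) kK; lra.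
by rewrite ler_pM2r//; nra.
Qed.

Section ClosedEnclosure.
Context {R : realType}.
Variables (c d : R) (X : set (\bar R * R)) (M : R).
Hypotheses (c0 : 0 <= c) (d0 : 0 < d) (cX : closed X).
Hypothesis bX : forall ab, X ab -> `|ab.2| <= M.

Notation cplx z := (z.1 +i* z.2)%C.

(** Each parameter has a neighbourhood excluding roots near [z]; compactness of [X] makes the
    neighbourhood of [z] uniform. *)
Lemma near_not_W_T (z : R * R) : ~ W_T c d X (Some (cplx z)) ->
  \forall z' \near z, ~ W_T c d X (Some (cplx z')).
Proof.
move=> nW.
have /compact_near_coveringP cov := closed_bounded_compact _ _ cX bX.
suff : \forall z' \near z, X `<=` (fun ab => ~ roots_at c d ab (Some (cplx z'))).
  by apply: filterS => z' h [ab Xab]; exact: h.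
refine (cov _ (nbhs z) (fun z' ab => ~ roots_at c d ab (Some (cplx z'))) _ _).
move=> [e b] Xeb.
have nr : ~ roots_at c d (e, b) (Some (cplx z)) by move=> ?; apply: nW; exists (e, b).
suff : \forall t \near filter_prod (nbhs (e, b)) (nbhs z),
  ~ roots_at c d (fst t) (Some (cplx (snd t))) by [].
have cab : fst t @[t --> filter_prod (nbhs (e, b)) (nbhs z)] --> (e, b).
  exact: cvg_fst.
have cz : snd t @[t --> filter_prod (nbhs (e, b)) (nbhs z)] --> z.
  exact: cvg_snd.
have := cvg_not_roots c d (fun t => (fst t).1) (fun t => (fst t).2)
  (fun t => (snd t).1) (fun t => (snd t).2) _ _ _ _
  (cvg_comp _ _ cab cvg_fst) (cvg_comp _ _ cab cvg_snd)
  (cvg_comp _ _ cz cvg_fst) (cvg_comp _ _ cz cvg_snd) nr.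
by move=> /(_ _ _ _ _ _); apply: filterS => -[[a' b'] z'].
Qed.

(** Infinity is a root at every infinite first parameter, so [X] has only finite ones. They are
    locally bounded, hence bounded by compactness. *)
Lemma not_W_T_infty : ~ W_T c d X None ->
  exists K : R, forall ab, X ab -> ab.1 \is a fin_num /\ `|fine ab.1| <= K.
Proof.
move=> nW.
have Xfin ab : X ab -> ab.1 \is a fin_num.
  case: ab => -[a||] b // Xab; case: nW.
    by exists (+oo%E, b) => //=; right.
  by exists (-oo%E, b) => //=; right.
have /compact_near_coveringP cov := closed_bounded_compact _ _ cX bX.
suff /filter_ex[K XK] : \forall K \near +oo, X `<=` (fun ab => `|fine ab.1| <= K).
  by exists K => ab Xab; split; [exact: Xfin|exact: XK].
refine (cov _ _ (fun K ab => `|fine ab.1| <= K) _ _) => -[e b] Xeb; have := Xfin _ Xeb; case: e Xeb => //= a Xab _.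
  pose V : set (\bar R * R) := [set ab | `|fine ab.1| <= `|a| + 1].
  have nV : nbhs (a%:E, b) V.
    have ca : fst t @[t --> nbhs (a%:E, b)] --> a%:E by exact: cvg_fst.
    have cf : fine (fst t) @[t --> nbhs (a%:E, b)] --> a by exact: fine_cvg ca.
    have : `|a| < `|a| + 1 by rewrite ltrDl.
    move=> /(cvgr_norm_lt _ cf).
    by apply: filterS => t /ltW.
  exists (V, [set K | `|a| + 1 <= K]).
    split => //=; apply: nbhs_pinfty_ge; exact: num_real.
  by move=> [ab K] /= [Vab /(le_trans _)]; apply.
Qed.

(** Taking moduli in [(a - w^2) q = b w^2] and applying the reverse triangle inequality to both
    factors on the left gives the hypotheses of [norm_bound]. *)
Lemma root_bound (K a b : R) (w : R[i]) : `|a| <= K -> `|b| <= K ->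
  p_ab c d a b w = 0 -> (Normc.normc w : R) < 4 * (K + c + d + 1).
Proof.
move=> aK bK /eqP; rewrite subr_eq0 => /eqP /(congr1 (@Normc.normc R)).
rewrite !Normc.normcM.
have nD (u v : R[i]) : Normc.normc (u + v) <= Normc.normc u + Normc.normc v.
  exact: le_normcD.
have nN (u : R[i]) : Normc.normc (- u) = Normc.normc u by exact: normcN.
have nn (u : R[i]) : 0 <= Normc.normc u by case: u => ? ?; exact: sqrtr_ge0.
have nR (u : R) : Normc.normc u%:C%C = `|u|.
  by rewrite /= expr0n addr0 sqrtr_sqr.
pose r : R := Normc.normc w.
have n2 : Normc.normc (w ^+ 2) = r ^+ 2 by rewrite expr2 Normc.normcM.
have tri (u v : R[i]) :
    Normc.normc v <= Normc.normc (u - v) + Normc.normc u.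
  have -> : Normc.normc v = Normc.normc (u - v - u).
    by rewrite addrAC subrr add0r nN.
  by apply: (le_trans (nD _ _)); rewrite nN.
have h1 : r ^+ 2 <= Normc.normc (a%:C%C - w ^+ 2) + K.
  by rewrite -n2; apply: (le_trans (tri a%:C%C _)); rewrite lerD2l nR.
have h2 : r ^+ 2 <= Normc.normc (c%:C%C - 'i%C * d%:C%C * w - w ^+ 2) + (c + d * r).
  rewrite -n2; apply: (le_trans (tri (c%:C%C - 'i%C * d%:C%C * w) _)).
  rewrite lerD2l; apply: (le_trans (nD _ _)).
  rewrite nN !Normc.normcM !nR (ger0_norm c0) (gtr0_norm d0) /=.
  by rewrite expr0n add0r expr1n sqrtr1 mul1r.
rewrite nR -/r -expr2 => E.
exact: (norm_bound _ _ _ _ _ _ `|b| c0 d0 (normr_ge0 b) bK (nn _) (nn _) h1 h2 E).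
Qed.

Lemma W_T_closed (z : option R[i]) : ~ W_T c d X z ->
  exists2 e, 0 < e & forall y, sphere_ball z e y -> ~ W_T c d X y.
Proof.
case: z => [[x y]|] nW.
  have [e e0 eP] := near_sphere_ball _ _ (near_not_W_T (x, y) nW).
  by exists e => // w /eP[z' ->].
have [K XK] := not_W_T_infty nW.
(* A point of [X] yields [0 <= M]; the empty set has an empty enclosure. *)
have [->|/set0P[ab0 Xab0]] := eqVneq X set0.
  by exists 1 => // y _ [].
pose N : R := `|K| + M.
have M0 : 0 <= M by apply: le_trans (bX _ Xab0).
have MN : M <= N by rewrite lerDr.
have KN : K <= N by apply: le_trans (ler_norm K) _; rewrite lerDl.
have N0 : 0 <= N by exact: le_trans MN.
have B0 : 0 < 4 * (N + c + d + 1).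
  by rewrite mulr_gt0// ltr_wpDl// addr_ge0// ?addr_ge0// ltW.
(* A ball of radius [e] about infinity consists of the moduli above [e^-1], so the radius is the
   inverse of the root bound. *)
exists (4 * (N + c + d + 1))^-1; rewrite ?invr_gt0// => y [->//|[w [-> +]]] [[e b] Xeb].
have [/=] := XK _ Xeb; have /= := bX _ Xeb.
case: e Xeb => //= a _ bM _ aK; rewrite invrK => Bw [w' [[<-]]].
move=> /(root_bound _ _ _ _ (le_trans aK KN) (le_trans bM MN)).
rewrite ltNge => /negP; apply; apply: ltW.
by case: w Bw => u v; rewrite normc_def ltcR.
Qed.

End ClosedEnclosure.

(** * Stability of roots under small changes of the parameters *)

Section RootNear.
Context {R : realType}.
Variables (c d : R).

Lemma p_ab_horner (a b : R) : exists2 p : {poly R[i]},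
  p \is monic /\ size p = 5%N & forall w, p.[w] = p_ab c d a b w.
Proof.
pose e : R[i] := 'i%C * d%:C%C.
pose q := Poly [:: a%:C%C * c%:C%C; - (a%:C%C * e);
                   - (a%:C%C + c%:C%C + b%:C%C); e].
have sq : (size q < size ('X^4 : {poly R[i]}))%N.
  by rewrite size_polyXn ltnS; exact: size_Poly.
exists ('X^4 + q).
  by rewrite monicE lead_coefDl// lead_coefXn size_polyDl// size_polyXn.
move=> w; rewrite hornerD hornerXn horner_Poly /= /p_ab -/e.
by ring.
Qed.

(** The monic quartic is a product of four linear factors. If all roots were at distance at least
    [e] from [w], its modulus at [w] would be at least [e ^ 4]. This serves as continuity of the
    roots without labelling them. *)
Lemma exists_root_near (a b : R) (w : R[i]) (e : R) : 0 < e ->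
  `|p_ab c d a b w| < (e ^+ 4)%:C%C ->
  exists2 w', p_ab c d a b w' = 0 & `|w' - w| < e%:C%C.
Proof.
move=> e0; have [p [pm sp] pE] := p_ab_horner a b.
have [r pr] := closed_field_poly_normal p.
rewrite (monicP pm) scale1r in pr.
have sr : size r = 4%N by move: sp; rewrite pr size_prod_XsubC => -[].
move=> pw; apply: contrapT => noroot.
move: pw; rewrite -pE {1}pr horner_prod normr_prod -sr real_ltNge ?normr_real//; last first.
- by rewrite complex_real.
- by rewrite rpred_prod// => z _; exact: normr_real.
move=> /negP; apply.
have : forall z, z \in r -> e%:C%C <= `|('X - z%:P).[w]|.
  move=> z zr; rewrite hornerXsubC distrC real_leNgt ?normr_real ?complex_real//.
  apply/negP => zw; apply: noroot; exists z => //.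
  by apply/eqP; rewrite -pE pr -/(root _ _) root_prod_XsubC.
elim: (r) => [|z s IH] zs; first by rewrite big_nil expr0.
rewrite big_cons exprS rmorphM /= ler_pM ?ler0c ?exprn_ge0 ?(ltW e0)//.
- by apply: zs; rewrite mem_head.
- by apply: IH => y ys; apply: zs; rewrite in_cons ys orbT.
Qed.

End RootNear.

(** * Passing from roots over [X] to roots over its boundary *)

Section BoundaryRoots.
Context {R : realType}.
Variables (c d : R) (X : set (\bar R * R)) (M : R).
Hypotheses (c0 : 0 <= c) (d0 : 0 < d) (cX : closed X).
Hypothesis bX : forall ab, X ab -> `|ab.2| <= M.

Lemma W_T_tboundary_sub : W_T c d (tboundary X) `<=` W_T c d X.
Proof. by move=> z [ab /(tboundary_sub _ cX) Xab rz]; exists ab. Qed.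

Lemma W_T_infty : W_T c d X None -> W_T c d (tboundary X) None.
Proof.
move=> [[e b] Xeb re]; have [b' Xb'] := tboundary_vertical _ _ _ _ cX bX Xeb.
by exists (e, b') => //; case: e re {Xeb Xb'}; [move=> a [w []]|..].
Qed.

(** Where [q] vanishes, the equation at finite parameters reduces to [b w^2 = 0]. If [b = 0], the
    first parameter is free; if [w = 0], the second is. At infinite parameters the second is always
    free. *)
Lemma W_T_zero_q (x y : R) : qre c d x y = 0 -> qim d x y = 0 ->
  W_T c d X (Some (x +i* y)%C) -> W_T c d (tboundary X) (Some (x +i* y)%C).
Proof.
move=> q1 q2 [[e b] Xeb re].
have [efin|einf] := boolP (e \is a fin_num); last first.
  have [b' Xb'] := tboundary_vertical _ _ _ _ cX bX Xeb.
  by exists (e, b') => //; apply/roots_at_infty.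
move: e efin Xeb re => [a||]// _ Xab /roots_at_fin[].
rewrite /pre /pim q1 q2 !mulr0 addr0 subr0 !sub0r => s1 s2.
have [b00|bn0] := eqVneq b 0.
  have [[e' b'] Xb' eb'] := tboundary_horizontal _ _ _ _ cX bX Xab.
  exists (e', b') => //; have [e'fin|e'inf] := boolP (e' \is a fin_num).
    move: e'fin Xb' eb' => /[dup] + /[swap] _; case: e' => [a'||]// _ Xb' /(_ isT)/= ->.
    by apply/roots_at_fin; rewrite /pre /pim q1 q2 b00 !mulr0 !mul0r !addr0 !subrr.
  by apply/roots_at_infty.
have {}s1 : sqre x y = 0.
  by apply: (mulfI bn0); rewrite mulr0 -[LHS]opprK s1 oppr0.
have {}s2 : sqim x y = 0.
  by apply: (mulfI bn0); rewrite mulr0 -[LHS]opprK s2 oppr0.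
have [b' Xb'] := tboundary_vertical _ _ _ _ cX bX Xab.
exists (a%:E, b') => //; apply/roots_at_fin.
by rewrite /pre /pim q1 q2 s1 s2 !mulr0 !addr0 !subrr.
Qed.

Lemma W_T_imag (y : R) :
  W_T c d X (Some (0 +i* y)%C) -> W_T c d (tboundary X) (Some (0 +i* y)%C).
Proof.
have qi : qim d 0 y = 0 by rewrite /qim /sqim; ring.
have [q0|q0] := eqVneq (qre c d 0 y) 0; first exact: W_T_zero_q.
move=> [[e b] Xeb re]; have [efin|einf] := boolP (e \is a fin_num); last first.
  by have [q00 _] := iffLR (roots_at_infty _ _ _ _ _ _ einf) re; rewrite q00 eqxx in q0.
(* On the imaginary axis [pim] vanishes identically, and [pre = 0] is solved for [a] as an affine
   function of [b]. *)
pose f t := ((- (y * y) - t * (y * y) / qre c d 0 y)%:E, t).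
have root_f t : roots_at c d (f t) (Some (0 +i* y)%C).
  apply/roots_at_fin; rewrite /pre /pim qi /sqre /sqim; split; last by ring.
  by field.
have Xf : X (f b).
  move: e efin Xeb re => [a||]// _ Xab /roots_at_fin[+ _].
  rewrite /pre qi mulr0 addr0 => p0; suff -> : f b = (a%:E, b) by [].
  congr (_%:E, _); apply: (mulIf q0); rewrite mulrBl divfK//.
  by move: p0; rewrite /sqre; lra.
have cf : continuous f.
  apply: continuous_pair_fun => t; last exact: cvg_id.
  apply: continuous_comp; last exact: EFin_continuous.
  apply: cvgB; first exact: cvg_cst.
  by apply: cvgM; [apply: cvgM; [exact: cvg_id|exact: cvg_cst]|exact: cvg_cst].
have [r Xr] : exists r, tboundary X (f r).
  apply: (path_meets_tboundary _ _ b (`|M| + 1) cX cf Xf) => /bX /=.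
  by rewrite ger0_norm ?addr_ge0// leNgt (le_lt_trans (ler_norm M))// ltrDl.
by exists (f r).
Qed.

Lemma W_T_rdet (x y : R) : rdet c d x y != 0 ->
  W_T c d X (Some (x +i* y)%C) <-> X ((sol_a c d x y)%:E, sol_b c d x y).
Proof.
move=> D0; split=> [[[e b] Xeb re]|Xs]; last first.
  by eexists; first exact: Xs; apply/roots_at_fin/pre_pim_sol.
have [efin|einf] := boolP (e \is a fin_num); last first.
  have [q1 q2] := iffLR (roots_at_infty _ _ _ _ _ _ einf) re.
  by rewrite rdetE q1 q2 !mulr0 subrr eqxx in D0.
move: e efin Xeb re => [a||]// _ Xab /roots_at_fin.
by move=> /(iffLR (pre_pim_sol _ _ _ _ _ _ D0))[<- <-].
Qed.

Lemma W_T_rdet0 (x y : R) (Y : set (\bar R * R)) : x != 0 -> rdet c d x y = 0 ->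
  W_T c d Y (Some (x +i* y)%C) -> qre c d x y = 0 /\ qim d x y = 0.
Proof.
move=> x0 D0 [[e b] _ re].
have [efin|einf] := boolP (e \is a fin_num); last exact/(roots_at_infty _ _ _ _ _ _ einf)/re.
move: e efin re => [a||]// _ /roots_at_fin[p1 p2].
exact: (rdet0_pre_pim _ _ _ _ _ _ (lt0r_neq0 d0) D0 x0 p1 p2).
Qed.

Lemma cvg_sol (x y : R) : rdet c d x y != 0 ->
  ((sol_a c d z.1 z.2)%:E, sol_b c d z.1 z.2) @[z --> (x, y)] -->
  ((sol_a c d x y)%:E, sol_b c d x y).
Proof.
move=> D0.
have c1 : z.1 @[z --> (x, y)] --> x by exact: cvg_fst.
have c2 : z.2 @[z --> (x, y)] --> y by exact: cvg_snd.
have ca : (sol_a c d z.1 z.2)%:E @[z --> (x, y)] --> (sol_a c d x y)%:E.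
  have cs : sol_a c d z.1 z.2 @[z --> (x, y)] --> sol_a c d x y.
    exact: cvg_sol_a.
  exact: (cvg_comp _ _ cs (EFin_continuous _)).
have cb : sol_b c d z.1 z.2 @[z --> (x, y)] --> sol_b c d x y.
  exact: cvg_sol_b.
exact: (cvg_pair ca cb).
Qed.

Lemma near_rdet (x y : R) : rdet c d x y != 0 ->
  \forall z \near (x, y), rdet c d z.1 z.2 != 0.
Proof.
have c1 : z.1 @[z --> (x, y)] --> x by exact: cvg_fst.
have c2 : z.2 @[z --> (x, y)] --> y by exact: cvg_snd.
have cD : rdet c d z.1 z.2 @[z --> (x, y)] --> rdet c d x y by exact: cvg_rdet.
by move=> D0; exact: cvgr_neq0 cD D0.
Qed.

Lemma sphere_boundary_W_T (x y : R) : x != 0 ->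
  sphere_boundary (W_T c d X) (Some (x +i* y)%C) ->
  W_T c d (tboundary X) (Some (x +i* y)%C).
Proof.
move=> x0 bz.
have Wz : W_T c d X (Some (x +i* y)%C).
  apply: contrapT => /(W_T_closed _ _ _ _ c0 d0 cX bX)[e e0 eW].
  by have [[w [/eW]]] := bz e e0.
have [D0|D0] := eqVneq (rdet c d x y) 0.
  by have [q1 q2] := W_T_rdet0 _ _ _ x0 D0 Wz; exact: W_T_zero_q.
have Xs := iffLR (W_T_rdet _ _ D0) Wz.
have [sI|sI] := pselect (X^° ((sol_a c d x y)%:E, sol_b c d x y)); last first.
  exists ((sol_a c d x y)%:E, sol_b c d x y); last exact/roots_at_fin/pre_pim_sol.
  by split=> //; exact: subset_closure.
(* By continuity of the solution, an interior parameter would put a whole neighbourhood into the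
   enclosure, so the point could not be on its boundary. *)
have nX : \forall z \near (x, y), X ((sol_a c d z.1 z.2)%:E, sol_b c d z.1 z.2).
  exact: (cvg_sol _ _ D0 _ sI).
have nP : nbhs (x, y) (fun z => W_T c d X (Some (z.1 +i* z.2)%C)).
  have nD := near_rdet _ _ D0.
  near=> z; apply/W_T_rdet; first by near: z.
  by near: z.
have [e e0 eP] := near_sphere_ball (x, y) _ nP.
by have [_ [w [/eP[z' -> ?]]]] := bz e e0.
Unshelve. all: by end_near. Qed.

(** * Points outside the enclosure arbitrarily close to boundary roots *)

Lemma not_interior_fin (a b : R) (P : R -> R -> Prop) :
  ~ X^° (a%:E, b) -> (\forall a' \near a & b' \near b, P a' b') ->
  exists a' b', ~ X (a'%:E, b') /\ P a' b'.
Proof.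
move=> nI [[U V] /= [Ua Vb] UVP]; apply: contrapT => nE; apply: nI.
(* Images of real neighbourhoods are neighbourhoods of [a%:E], so the parameter outside [X] can be
   chosen finite. *)
exists (EFin @` U, V) => /=.
  by split => //; apply/nbhs_EFin; apply: filterS Ua => u Uu; exists u.
move=> [_ b'] [/= [a' Ua' <-] Vb']; apply: contrapT => nXab; apply: nE.
by exists a', b'; split => //; exact: (UVP (a', b')).
Qed.

Lemma near_small_p (a b x y e : R) : 0 < e -> p_ab c d a b (x +i* y)%C = 0 ->
  \forall a' \near a & b' \near b,
    `|p_ab c d a' b' (x +i* y)%C| < (e ^+ 4)%:C%C.
Proof.
move=> e0 /p_ab_eq0[p1 p2].
suff : \forall t \near (a, b),
    `|p_ab c d t.1 t.2 (x +i* y)%C| < (e ^+ 4)%:C%C by [].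
have ca : t.1 @[t --> (a, b)] --> a by exact: cvg_fst.
have cb : t.2 @[t --> (a, b)] --> b by exact: cvg_snd.
have c1 : pre c d t.1 t.2 x y @[t --> (a, b)] --> 0.
  have cx : (fun=> x) @ (a, b) --> x by exact: cvg_cst.
  have cy : (fun=> y) @ (a, b) --> y by exact: cvg_cst.
  by rewrite -p1; exact: cvg_pre.
have c2 : pim c d t.1 t.2 x y @[t --> (a, b)] --> 0.
  have cx : (fun=> x) @ (a, b) --> x by exact: cvg_cst.
  have cy : (fun=> y) @ (a, b) --> y by exact: cvg_cst.
  by rewrite -p2; exact: cvg_pim.
have e40 : 0 < e ^+ 4 / 2 by rewrite divr_gt0// exprn_gt0.
near=> t; rewrite p_abE; apply: complex_norm_lt; near: t.
  by apply: cvgr_norm_lt c1 _ _; rewrite normr0.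
by apply: cvgr_norm_lt c2 _ _; rewrite normr0.
Unshelve. all: by end_near. Qed.

Lemma near_outside_rdet (x y e : R) : 0 < e -> rdet c d x y != 0 ->
  W_T c d (tboundary X) (Some (x +i* y)%C) ->
  exists z, sphere_ball (Some (x +i* y)%C) e z /\ ~ W_T c d X z.
Proof.
move=> e0 D0 [[e' b] [Xab nI] re'].
have [efin|einf] := boolP (e' \is a fin_num); last first.
  have [q1 q2] := iffLR (roots_at_infty _ _ _ _ _ _ einf) re'.
  by rewrite rdetE q1 q2 !mulr0 subrr eqxx in D0.
move: e' efin Xab nI re' => [a||]// _ _ nI /roots_at_fin/p_ab_eq0 p0.
(* Within [r], the determinant stays nonzero. The perturbed root then determines its parameters,
   which lie outside [X]. *)
have [r r0 rP] := near_sphere_ball (x, y) _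
  (filterI (near_rdet _ _ D0) (sphere_ball_near (x, y) e e0)).
have [a' [b' [nXab pab]]] := not_interior_fin _ _ _ nI (near_small_p _ _ _ _ _ r0 p0).
have [w pw0 wr] := exists_root_near _ _ _ _ _ _ r0 pab.
have [|[x' y'] /= [wE] [D0' be]] := rP (Some w); first by exists w.
rewrite wE in pw0; exists (Some (x' +i* y')%C); split => // /(iffLR (W_T_rdet _ _ D0')).
have [<- <-] := iffLR (pre_pim_sol _ _ _ _ _ _ D0')
  (iffLR (p_ab_eq0 _ _ _ _ _ _) pw0).
exact: nXab.
Qed.

(* The zeros [delta_p], [delta_m] off the imaginary axis lie on the circle
   [rdet = 0], on which no other point belongs to the enclosure; [t] is a
   parameter of this circle, obtained from [w / (1 + t w)]. *)
Lemma near_outside_zero_q (x y e : R) : 0 < e -> x != 0 ->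
  qre c d x y = 0 -> qim d x y = 0 ->
  exists z, sphere_ball (Some (x +i* y)%C) e z /\ ~ W_T c d X z.
Proof.
move=> e0 x0 q1 q2.
have yE : y = - d / 2.
  move: q2; rewrite /qim /sqim.
  have -> : - (d * x) - 2 * x * y = x * - (d + 2 * y) by ring.
  by move=> /eqP; rewrite mulf_eq0 (negbTE x0)/= => /eqP; lra.
have xy : x * x + y * y = c.
  by move: q1; rewrite /qre /sqre yE => q1; lra.
(* Since [x * x + y * y = c], [N t] is the squared modulus of [1 + t w], and [X' t], [Y' t] are the
   real and imaginary parts of [w / (1 + t w)]. *)
pose N (t : R) := 1 + t * (2 * x + t * c).
pose X' t := (x + t * c) / N t.
pose Y' t := y / N t.
have id0 : t @[t --> (0 : R)^'] --> (0 : R).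
  by apply: cvg_trans (@cvg_id _ (nbhs (0 : R))); exact: cvg_within.
have cst (k : R) : (fun=> k) @ (0 : R)^' --> k by exact: cvg_cst.
have cL : 2 * x + t * c @[t --> 0^'] --> 2 * x + 0 * c.
  exact: (cvgD (cst (2 * x)) (cvgM id0 (cst c))).
rewrite mul0r addr0 in cL.
have cN : N t @[t --> 0^'] --> 1 + 0 * (2 * x).
  exact: (cvgD (cst 1) (cvgM id0 cL)).
rewrite mul0r addr0 in cN.
have n1 : (1 : R) != 0 by exact: oner_neq0.
have cX' : X' t @[t --> 0^'] --> (x + 0 * c) * 1^-1.
  exact: (cvgM (cvgD (cst x) (cvgM id0 (cst c))) (cvgV n1 cN)).
rewrite mul0r addr0 invr1 mulr1 in cX'.
have cY' : Y' t @[t --> 0^'] --> y * 1^-1 by exact: (cvgM (cst y) (cvgV n1 cN)).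
rewrite invr1 mulr1 in cY'.
have cXY : (X' t, Y' t) @[t --> 0^'] --> (x, y) by exact: (cvg_pair cX' cY').
have bt : \forall t \near (0 : R)^',
    sphere_ball (Some (x +i* y)%C) e (Some (X' t +i* Y' t)%C).
  exact: (cXY _ (sphere_ball_near (x, y) e e0)).
(* The first two conditions say [N t != 1]; since [y = - d / 2], this and [X' t != 0] make [qim]
   nonzero at the new point. *)
have : \forall t \near (0 : R)^', [/\ t != 0, 2 * x + t * c != 0, N t != 0, X' t != 0
    & sphere_ball (Some (x +i* y)%C) e (Some (X' t +i* Y' t)%C)].
  near=> t; split; near: t.
  - exact: nbhs_dnbhs_neq.
  - by apply: cvgr_neq0 cL _; rewrite mulf_neq0// pnatr_eq0.
  - by apply: cvgr_neq0 cN _; exact: oner_neq0.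
  - by apply: cvgr_neq0 cX' _.
  - exact: bt.
move=> /filter_ex[t [t0 L0 N0 X0 be]].
exists (Some (X' t +i* Y' t)%C); split => //.
have D0 : rdet c d (X' t) (Y' t) = 0.
  rewrite /rdet.
  have -> : X' t * X' t + Y' t * Y' t = c / N t.
    have E : (x + t * c) * (x + t * c) + y * y = c * N t.
      transitivity (x * x + y * y + c * (t * (2 * x + t * c))); first by ring.
      by rewrite xy /N; ring.
    transitivity (((x + t * c) * (x + t * c) + y * y) / N t / N t).
      by rewrite /X' /Y'; field.
    by rewrite E; field.
  by rewrite /Y' yE; field.
move=> /(W_T_rdet0 _ _ _ X0 D0)[_ /eqP].
rewrite /qim /sqim.
have -> : - (d * X' t) - 2 * X' t * Y' t
    = - X' t * (d * (t * (2 * x + t * c)) / N t).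
  by rewrite /Y' yE; have := N0; rewrite /N => N0'; field.
by rewrite !mulf_eq0 oppr_eq0 invr_eq0 (negbTE X0) (negbTE t0) (negbTE L0) (negbTE N0) gt_eqF.
Unshelve. all: by end_near. Qed.

Lemma near_outside (x y e : R) : 0 < e -> x != 0 ->
  W_T c d (tboundary X) (Some (x +i* y)%C) ->
  exists z, sphere_ball (Some (x +i* y)%C) e z /\ ~ W_T c d X z.
Proof.
move=> e0 x0 Wz; have [D0|D0] := eqVneq (rdet c d x y) 0.
  have [q1 q2] := W_T_rdet0 _ _ _ x0 D0 Wz.
  exact: near_outside_zero_q.
exact: near_outside_rdet.
Qed.

(** Far out on the diagonal [x = y], the determinant is of order at most [x ^ 3] while the numerator
    of [sol_b] is at least of order [x ^ 6], so the forced second parameter exceeds [M]. *)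
Lemma near_outside_infty (e : R) : 0 < e ->
  exists z, sphere_ball None e z /\ ~ W_T c d X z.
Proof.
(* The summands serve in turn to compare powers of [x], to dominate the determinant times [M], and
   to enter the ball about infinity. *)
move=> e0; pose x := 1 + `|M| * (c + d) + e^-1.
have ei : 0 < e^-1 by rewrite invr_gt0.
have Mcd : 0 <= `|M| * (c + d) by rewrite mulr_ge0// addr_ge0// ltW.
have x1 : 1 <= x by rewrite /x -addrA lerDl addr_ge0// ltW.
have xM : `|M| * (c + d) <= x.
  by rewrite /x -addrA addrCA lerDl addr_ge0// ltW.
have xe : e^-1 < x by rewrite /x ltrDr ltr_wpDr.
have x0 : 0 < x by exact: lt_le_trans x1.
exists (Some (x +i* x)%C); split.
  right; exists (x +i* x)%C; split => //; rewrite normc_def ltcR /=.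
  apply: (lt_le_trans xe); rewrite -[leLHS]ger0_norm ?(ltW x0)// -sqrtr_sqr.
  by rewrite ler_wsqrtr// lerDl sqr_ge0.
have D0 : 0 < rdet c d x x.
  by rewrite /rdet; rewrite mulr_gt0// ltr_wpDl// ?mulr_gt0// ?addr_gt0 ?mulr_gt0// !mulr_ge0// ltW.
move=> /(iffLR (W_T_rdet _ _ (lt0r_neq0 D0)))/bX /=.
apply/negP; rewrite -ltNge.
apply: (le_lt_trans (ler_norm _)).
rewrite /sol_b normrM normrN normfV (gtr0_norm D0) ltr_pdivlMr//.
apply: lt_le_trans (ler_norm _).
have -> : `|M| * rdet c d x x
    = 2 * x * x * (`|M| * c + `|M| * d * x) by rewrite /rdet; ring.
rewrite /sqim ltr_pM2l ?mulr_gt0//.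
have Mc : `|M| * c <= `|M| * c * x by rewrite ler_peMr// mulr_ge0.
have x2 : `|M| * c * x + `|M| * d * x <= x * x.
  by rewrite -mulrDl -mulrDr ler_pM2r.
have xx : x * x <= x * x * (x * x) by rewrite ler_peMr ?mulr_ge0 ?(ltW x0)//; nra.
have q2 : 4 * (x * x * (x * x)) <= qim d x x * qim d x x.
  have dx : 0 <= d * x by rewrite mulr_ge0 ?ltW.
  have -> : qim d x x * qim d x x = 4 * (x * x * (x * x))
      + (4 * (x * x) * (d * x) + d * x * (d * x)) by rewrite /qim /sqim; ring.
  by rewrite lerDl addr_ge0// !mulr_ge0 ?(ltW x0) ?ler0n ?(ltW d0).
have q1 : 0 <= qre c d x x * qre c d x x by rewrite -expr2 sqr_ge0.
have xx0 : 0 < x * x by rewrite mulr_gt0.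
apply: (le_lt_trans (lerD Mc (lexx _))); apply: (le_lt_trans x2).
apply: (le_lt_trans xx); apply: (@lt_le_trans _ _ (4 * (x * x * (x * x)))).
  by rewrite ltr_pMl ?mulr_gt0// ltr1n.
by apply: (le_trans q2); rewrite lerDr.
Qed.

End BoundaryRoots.

(** * The two features of [Omega], and the conclusion *)

Section NumericalRange.
Context {R : realType} {H : lmodType R[i]} (ip : H -> H -> R[i]).

(** Expanding the squared norms of [u + B u] and [u - B u] gives [2 |x| n <= k + n], with [n] and
    [k] the squared norms of [u] and [B u]. Since [k <= M ^ 2 * n], the constant [(M ^ 2 + 1) / 2]
    results. *)
Lemma num_range_bounded (B : H -> H) :
  inner_product ip -> bounded_selfadjoint ip B ->
  exists M : R, forall x, num_range ip setT B x -> `|x| <= M.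
Proof.
move=> [ipl ipC ip0 ipdef] [_ [M BM] Bsym].
exists ((M ^+ 2 + 1) / 2) => x [u [_ u0 xE]].
have ipr (v w1 w2 : H) (k : R) :
    ip v (k%:C%C *: w1 + w2) = k%:C%C * ip v w1 + ip v w2.
  by rewrite ipC ipl !(rmorphD, rmorphM) [X in X * _]conjc_real (ipC w1 v) (ipC w2 v).
have ipRe v : ip v v = (complex.Re (ip v v))%:C%C.
  by rewrite RRe_real// ger0_real.
have Re0 v : 0 <= complex.Re (ip v v) by rewrite -ler0c -ipRe.
pose n : R := complex.Re (ip u u).
have nn : n != 0.
  by apply/eqP => n0; apply: u0; apply: ipdef; rewrite ipRe -/n n0.
have n0 : 0 < n by rewrite lt_def nn Re0.
have nC : n%:C%C != 0 :> R[i] by rewrite eq_complex /= negb_and nn.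
have Bu : ip (B u) u = (x * n)%:C%C.
  by rewrite rmorphM /= -xE ipRe -/n divfK.
have Bu' : ip u (B u) = (x * n)%:C%C by rewrite -Bsym.
pose k : R := complex.Re (ip (B u) (B u)).
have kn : k <= M ^+ 2 * n.
  have : hnorm ip (B u) ^+ 2 <= (M * hnorm ip u) ^+ 2.
    by rewrite ler_sqr ?nnegrE ?BM// ?(le_trans _ (BM u))// sqrtr_ge0.
  by rewrite exprMn /hnorm !sqr_sqrtr ?Re0.
have sq (t : R) : 0 <= t * t * k + 2 * t * (x * n) + n.
  have := ip0 (t%:C%C *: B u + u).
  rewrite ipl !ipr Bu Bu' (ipRe (B u)) (ipRe u) -/k -/n -!rmorphM -!rmorphD -rmorphM -rmorphD /=.
  by rewrite ler0c; congr (_ <= _); ring.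
have := sq 1; have := sq (- 1).
move=> s1 s2; rewrite ler_pdivlMr// -(ler_pM2r n0).
by have [x0|x0] := ger0P x; lra.
Qed.

End NumericalRange.

Lemma closure_bounded {R : realType} (A : set R) (M : R) :
  (forall x, A x -> `|x| <= M) -> forall x, closure A x -> `|x| <= M.
Proof.
move=> AM x; have cI : closed `[- M, M]%classic by exact: interval_closed.
have : A `<=` `[- M, M]%classic.
  by move=> y /AM; rewrite ler_norml /= in_itv.
move=> /closure_subset/[apply]; rewrite -(iffLR (closure_id _) cI).
by rewrite /= in_itv /= ler_norml.
Qed.

Lemma closed_Omega {R : realType} {H : lmodType R[i]} (ip : H -> H -> R[i])
  (domA : set H) (A B : H -> H) : closed (Omega ip domA A B).
Proof.
rewrite /Omega; set I := closure (EFin @` _); set J := closure _.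
have -> : I `*` J = (fst @^-1` I) `&` (snd @^-1` J) by [].
apply: closedI; apply: preimage_closed; try exact: closed_closure.
- by move=> z _; exact: cvg_fst.
- by move=> z _; exact: cvg_snd.
Qed.

Lemma sphere_ball_center {R : realType} (z : option R[i]) (e : R) :
  0 < e -> sphere_ball z e z.
Proof.
case: z => [w|] e0; last by left.
by exists w; rewrite subrr normr0 ltcR.
Qed.

Theorem theorem2p9 (R : realType) (H : lmodType R[i]) (ip : H -> H -> R[i])
    (domA : set H) (A B : H -> H) (c d : R) :
  hilbert_space ip ->
  selfadjoint ip domA A ->
  bounded_selfadjoint ip B ->
  (exists u : H, B u <> 0) ->
  0 <= c -> 0 < d ->
  (W_T c d (Omega ip domA A B) `&` imag_axis
     = W_T c d (tboundary (Omega ip domA A B)) `&` imag_axis) /\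
  (sphere_boundary (W_T c d (Omega ip domA A B)) `\` imag_axis
     = W_T c d (tboundary (Omega ip domA A B)) `\` imag_axis).
Proof.
move=> [ip_inner _] _ bB _ c0 d0; set X := Omega _ _ _ _.
have cX : closed X by exact: closed_Omega.
have [M BM] := num_range_bounded _ _ ip_inner bB.
have bX (ab : \bar R * R) : X ab -> `|ab.2| <= M.
  by case=> _; exact: closure_bounded.
split; apply/seteqP; split.
- move=> z [Wz [y zE]]; split; last by exists y.
  by move: Wz; rewrite zE; exact: (W_T_imag _ _ _ _ cX bX).
- by move=> z [/(W_T_tboundary_sub _ _ _ cX) Wz iz].
- move=> z [bz niz]; split => //; case: z bz niz => [[x y]|] bz niz.
    apply: (sphere_boundary_W_T _ _ _ _ c0 d0 cX bX _ _ _ bz).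
    by apply: contra_notN niz => /eqP ->; exists y.
  (* Infinity is not in [imag_axis], so it needs its own argument: closedness puts it into the
     enclosure. *)
  apply: (W_T_infty _ _ _ _ cX bX); apply: contrapT.
  move=> /(W_T_closed _ _ _ _ c0 d0 cX bX)[e e0 eW].
  by have [[w [/eW]]] := bz e e0.
- move=> z [Wz niz]; split => // e e0; split.
    exists z; split; first exact: sphere_ball_center.
    exact: (W_T_tboundary_sub _ _ _ cX _ Wz).
  case: z Wz niz => [[x y]|] Wz niz.
    apply: (near_outside _ _ _ d0 _ _ _ e0 _ Wz).
    by apply: contra_notN niz => /eqP ->; exists y.
  exact: (near_outside_infty _ _ _ _ c0 d0 bX _ e0).
Qed.
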